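(* For a 2-monad $\mathbb{T}=(T,\mu,\eta)$ on $V\text{-}\mathbf{Cat}$, the following assertions are equivalent: (i) $\mathbb{T}$ is isomorphic (as a monad) to the submonad of the presheaf monad $\mathbb{P}$ induced by $\Phi$, for some admissible class $\Phi$ of $V$-distributors; (ii) $\mathbb{T}$ is a submonad of the presheaf monad $\mathbb{P}$.
   Context: $V$ is a commutative unital quantale: a complete lattice with a commutative, associative tensor $\otimes$, with unit $k\neq\bot$, preserving arbitrary joins in each variable; $\hom(u,-)$ is right adjoint to $u\otimes-$. A $V$-category $(X,a)$ is a set $X$ with $a:X\times X\to V$ (also written $X(x,x')=a(x,x')$) such that $k\le a(x,x)$ and $a(x,x')\otimes a(x',x'')\le a(x,x'')$; a $V$-functor $f:(X,a)\to(Y,b)$ is a map with $a(x,x')\le b(f(x),f(x'))$; it is fully faithful if $a(x,x')=b(f(x),f(x'))$ always, and an embedding if it is moreover injective. For $V$-functors $f,g:X\to Y$, $f\le g$ means $k\le Y(f(x),g(x))$ for all $x$; this (pre)order gives the 2-cells of the 2-category $V\text{-}\mathbf{Cat}$, and a 2-monad on $V\text{-}\mathbf{Cat}$ is a monad whose functor is monotone on hom-sets. A $V$-relation $r:X\to Y$ between sets is a map $X\times Y\to V$; composition is $(s\cdot r)(x,z)=\bigvee_y r(x,y)\otimes s(y,z)$, order is pointwise. A $V$-distributor $\varphi$ from $(X,a)$ to $(Y,b)$ is a $V$-relation $X\to Y$ with $\varphi\cdot a\le\varphi$ and $b\cdot\varphi\le\varphi$. A $V$-functor $f:(X,a)\to(Y,b)$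 induces distributors $f_*$ from $X$ to $Y$, $f_*(x,y)=Y(f(x),y)$, and $f^*$ from $Y$ to $X$, $f^*(y,x)=Y(y,f(x))$. $E=(\{*\},k)$ is the one-point $V$-category; a point $x\in X$ is identified with the $V$-functor $E\to X$ with value $x$, so $x^*$ is the distributor $X(-,x)$ from $X$ to $E$. Presheaf monad $\mathbb{P}=(P,m,y)$: $PX$ is the set of distributors from $X$ to $E$ with $PX(\varphi,\psi)=\bigwedge_{x\in X}\hom(\varphi(x),\psi(x))$ (writing $\varphi(x)=\varphi(x,* )$); $Pf(\varphi)=\varphi\cdot f^*$; $y_X(x)=x^*$; $m_X:PPX\to PX$, $m_X(\Gamma)=\Gamma\cdot(y_X)_*$ (the right adjoint of $Py_X$). A monad morphism $\sigma:(T,\mu,\eta)\to(T',\mu',\eta')$ is a natural transformation $\sigma:T\to T'$ with $\sigma\cdot\eta=\eta'$ and $\mu'_X\cdot T'\sigma_X\cdot\sigma_{TX}=\sigma_X\cdot\mu_X$. A submonad of $\mathbb{P}$ is a 2-monad $\mathbb{T}$ on $V\text{-}\mathbf{Cat}$ together with a monad morphism $\sigma:\mathbb{T}\to\mathbb{P}$ with every $\sigma_X$ an embedding. For a class $\Phi$ of $V$-distributors, $\Phi X=\{\varphi\in PX\mid\varphi\in\Phi\}$ with the structure inherited from $PX$. $\Phi$ is admissible if, for every $V$-functor $f:X\to Y$ and distributors $\varphi$ from $Z$ to $Y$ and $\psi$ from $X$ to $Z$ in $\Phi$: (1) $f^*\in\Phi$; (2) $\psi\cdot f^*\in\Phi$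 and $f^*\cdot\varphi\in\Phi$; (3) for any distributor $\varphi$ from $Z$ to $Y$, $\varphi\in\Phi$ if and only if $y^*\cdot\varphi\in\Phi$ for all $y\in Y$; (4) for every distributor $\gamma$ from $PX$ to $E$, if the restriction of $\gamma$ to $\Phi X$ belongs to $\Phi$, then $\gamma\cdot(y_X)_*\in\Phi$. The submonad of $\mathbb{P}$ induced by an admissible $\Phi$ has functor $X\mapsto\Phi X$ with $\Phi f$ the (co)restriction of $Pf$, unit $y^\Phi_X:X\to\Phi X$ the corestriction of $y_X$, and multiplication $\Phi\Phi X\to\Phi X$, $\gamma\mapsto\gamma\cdot(y^\Phi_X)_*$, with $\sigma_X:\Phi X\to PX$ the inclusion. *)

(* Defs.v *)
From HB Require Import structures.
From mathcomp Require Import all_boot all_order.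
From mathcomp Require Import boolp classical_sets.

Set Implicit Arguments.
Unset Strict Implicit.
Unset Printing Implicit Defensive.

Import Order.TTheory.

Local Open Scope classical_set_scope.
Local Open Scope order_scope.

Declare Scope vcat_scope.
Delimit Scope vcat_scope with vcat.
Local Open Scope vcat_scope.

Reserved Notation "u ⊗ v" (at level 40, left associativity).
Reserved Notation "s ∙ r" (at level 45, left associativity).
Reserved Notation "psi ⊙ phi" (at level 45, left associativity).
Reserved Notation "g \vo f" (at level 50, left associativity).

HB.mixin Record isQuantale d V of Order.POrder d V := {
  vsup : set V -> V;
  vsup_supremums : forall A : set V, supremums A (vsup A);
  tens : V -> V -> V;
  vone : V;
  tensA : associative tens;
  tensC : commutative tens;
  tens1v : left_id vone tens;
  tens_sup : forall (u : V) (A : set V), tens u (vsup A) = vsup (tens u @` A);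
  (* vsup set0 is the bottom element *)
  vone_neq_bot : vone <> vsup set0
}.

#[short(type="quantaleType")]
HB.structure Definition Quantale d := {V of Order.POrder d V & isQuantale d V}.

Notation "u ⊗ v" := (tens u v) : vcat_scope.

Section QuantaleTheory.
Context {d : Order.disp_t} {V : quantaleType d}.
Implicit Types (u v w : V) (A : set V).

Definition vinf A : V := vsup (lbound A).

(* the right adjoint of u ⊗ -, see tens_vhom *)
Definition vhom u v : V := vsup [set w | u ⊗ w <= v].

Lemma le_vsup A v : A v -> v <= vsup A.
Proof. by case: (vsup_supremums A) => + _; apply. Qed.

Lemma vsup_le A v : (forall w, A w -> w <= v) -> vsup A <= v.
Proof. by case: (vsup_supremums A) => _; apply. Qed.

Lemma vinf_le A v : A v -> vinf A <= v.
Proof. by move=> Av; apply: vsup_le => w; apply. Qed.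

Lemma le_vinf A v : (forall w, A w -> v <= w) -> v <= vinf A.
Proof. by move=> vA; apply: le_vsup. Qed.

Lemma tensv1 v : v ⊗ vone = v.
Proof. by rewrite tensC tens1v. Qed.

Lemma tens_mono u v w : v <= w -> u ⊗ v <= u ⊗ w.
Proof.
move=> vw; have -> : w = vsup [set v; w].
  apply/le_anti/andP; split; first by apply: le_vsup; right.
  by apply: vsup_le => _ [->|->].
by rewrite tens_sup; apply: le_vsup; exists v => //; left.
Qed.

Lemma tens_le u u' v v' : u <= u' -> v <= v' -> u ⊗ v <= u' ⊗ v'.
Proof.
move=> uu' vv'; apply: (le_trans (tens_mono u vv')).
by rewrite [u ⊗ _]tensC [u' ⊗ _]tensC; apply: tens_mono.
Qed.

Lemma tens_vhom u v w : (u ⊗ w <= v) = (w <= vhom u v).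
Proof.
apply/idP/idP => [|H]; first by move=> ?; apply: le_vsup.
apply: (le_trans (tens_mono u H)); rewrite tens_sup.
by apply: vsup_le => _ [z /= ? <-].
Qed.

End QuantaleTheory.

Record vcat {d : Order.disp_t} (V : quantaleType d) := VCat {
  vob :> Type;
  vmor : vob -> vob -> V;
  vmor_refl : forall x, vone <= vmor x x;
  vmor_trans : forall x y z, vmor x y ⊗ vmor y z <= vmor x z
}.

Record vfun {d : Order.disp_t} {V : quantaleType d} (X Y : vcat V) := VFun {
  vfun_fun :> X -> Y;
  vfunP : forall x x', vmor x x' <= vmor (vfun_fun x) (vfun_fun x')
}.

Section VCat.
Context {d : Order.disp_t} {V : quantaleType d}.
Implicit Types X Y Z : vcat V.

Definition vfun_le X Y (f g : vfun X Y) : Prop :=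
  forall x, vone <= vmor (f x) (g x).

Definition fully_faithful X Y (f : vfun X Y) : Prop :=
  forall x x', vmor x x' = vmor (f x) (f x').

Definition vembedding X Y (f : vfun X Y) : Prop :=
  fully_faithful f /\ injective f.

Lemma vfun_eq X Y (f g : vfun X Y) : f =1 g -> f = g.
Proof.
case: f g => [f fP] [g gP] /= /funext fg.
by case: _ / fg gP => gP; congr VFun.
Qed.

Definition vid X : vfun X X := VFun (fun x x' => lexx (vmor x x')).

Definition vcomp X Y Z (g : vfun Y Z) (f : vfun X Y) : vfun X Z :=
  VFun (vfun_fun := g \o f) (fun x x' => le_trans (vfunP f x x') (vfunP g _ _)).

Definition vE : vcat V :=
  @VCat d V unit (fun _ _ => vone) (fun=> lexx _)
    (fun _ _ _ => eq_ind_r (fun z => z <= vone) (lexx vone) (tens1v vone)).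

Definition vpoint X (x : X) : vfun vE X :=
  @VFun d V vE X (fun=> x) (fun _ _ => vmor_refl x).

End VCat.

Arguments vid {d V} X.
Arguments vE {d} V.

Notation "g \vo f" := (vcomp g f) : vcat_scope.

(* s ∙ r is r, then s *)
Definition relcomp {d : Order.disp_t} {V : quantaleType d} (X Y Z : Type)
    (s : Y -> Z -> V) (r : X -> Y -> V) : X -> Z -> V :=
  fun x z => vsup [set r x y ⊗ s y z | y in [set: Y]].

Notation "s ∙ r" := (relcomp s r) : vcat_scope.

Record distributor {d : Order.disp_t} {V : quantaleType d} (X Y : vcat V) :=
  Distributor {
    drel :> X -> Y -> V;
    dist_dom : forall x y, (drel ∙ @vmor d V X) x y <= drel x y;
    dist_cod : forall x y, (@vmor d V Y ∙ drel) x y <= drel x y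
  }.

Section Distributors.
Context {d : Order.disp_t} {V : quantaleType d}.
Implicit Types X Y Z W : vcat V.

Lemma relcomp_le (A B C : Type) (s : B -> C -> V) (r : A -> B -> V) x z v :
  (forall y, r x y ⊗ s y z <= v) -> (s ∙ r) x z <= v.
Proof. by move=> H; apply: vsup_le => _ [y _ <-]. Qed.

Lemma le_relcomp (A B C : Type) (s : B -> C -> V) (r : A -> B -> V) x y z :
  r x y ⊗ s y z <= (s ∙ r) x z.
Proof. by apply: le_vsup; exists y. Qed.

Lemma relcompA (A B C D : Type) (t : C -> D -> V) (s : B -> C -> V)
  (r : A -> B -> V) : t ∙ (s ∙ r) = (t ∙ s) ∙ r.
Proof.
apply/funext => x; apply/funext => w; apply/le_anti/andP; split.
  apply: relcomp_le => z; rewrite tensC tens_sup.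
  apply: vsup_le => _ [_ [y _ <-] <-]; rewrite tensC -tensA.
  by apply: le_trans (le_relcomp _ _ _ y _); apply: tens_mono; apply: le_relcomp.
apply: relcomp_le => y; rewrite tens_sup.
apply: vsup_le => _ [_ [z _ <-] <-]; rewrite tensA.
apply: le_trans (le_relcomp _ _ _ z _); rewrite ![_ ⊗ t _ _]tensC.
by apply: tens_mono; apply: le_relcomp.
Qed.

Lemma relcomp_mono (A B C : Type) (s s' : B -> C -> V) (r r' : A -> B -> V) :
  (forall y z, s y z <= s' y z) -> (forall x y, r x y <= r' x y) ->
  forall x z, (s ∙ r) x z <= (s' ∙ r') x z.
Proof.
move=> ss rr x z; apply: relcomp_le => y.
by apply: le_trans (le_relcomp _ _ _ y _); apply: tens_le.
Qed.

Lemma distributor_eq X Y (phi psi : distributor X Y) :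
  (forall x y, phi x y = psi x y) -> phi = psi.
Proof.
case: phi psi => [r r1 r2] [s s1 s2] /= rs.
have {}rs : r = s by apply/funext => x; apply/funext.
by case: _ / rs s1 s2 => s1 s2; congr Distributor.
Qed.

Lemma dist_doml X Y (phi : distributor X Y) x x' y :
  vmor x x' ⊗ phi x' y <= phi x y.
Proof.
exact: le_trans (le_relcomp phi (@vmor _ _ X) x x' y) (dist_dom _ _ _).
Qed.

Lemma dist_codr X Y (phi : distributor X Y) x y y' :
  phi x y ⊗ vmor y y' <= phi x y'.
Proof.
exact: le_trans (le_relcomp (@vmor _ _ Y) phi x y y') (dist_cod _ _ _).
Qed.

Lemma mk_dist_dom X Y (r : X -> Y -> V) :
  (forall x x' y, vmor x x' ⊗ r x' y <= r x y) ->
  forall x y, (r ∙ @vmor d V X) x y <= r x y.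
Proof. by move=> H x y; apply: relcomp_le. Qed.

Lemma mk_dist_cod X Y (r : X -> Y -> V) :
  (forall x y y', r x y ⊗ vmor y y' <= r x y') ->
  forall x y, (@vmor d V Y ∙ r) x y <= r x y.
Proof. by move=> H x y; apply: relcomp_le. Qed.

Fact dcomp_dom X Y Z (psi : distributor Y Z) (phi : distributor X Y) x z :
  ((psi ∙ phi) ∙ @vmor d V X) x z <= (psi ∙ phi) x z.
Proof. by rewrite -relcompA; apply: relcomp_mono => // *; apply: dist_dom. Qed.

Fact dcomp_cod X Y Z (psi : distributor Y Z) (phi : distributor X Y) x z :
  (@vmor d V Z ∙ (psi ∙ phi)) x z <= (psi ∙ phi) x z.
Proof. by rewrite relcompA; apply: relcomp_mono => // *; apply: dist_cod. Qed.

Definition dcomp X Y Z (psi : distributor Y Z) (phi : distributor X Y) :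
  distributor X Z := Distributor (dcomp_dom psi phi) (dcomp_cod psi phi).

Fact lstar_dom X Y (f : vfun X Y) x y :
  ((fun x y => vmor (f x) y) ∙ @vmor d V X) x y <= vmor (f x) y.
Proof.
apply: relcomp_le => x'; apply: le_trans (vmor_trans (f x) (f x') y).
by apply: tens_le => //; apply: vfunP.
Qed.

Fact lstar_cod X Y (f : vfun X Y) x y :
  (@vmor d V Y ∙ (fun x y => vmor (f x) y)) x y <= vmor (f x) y.
Proof. by apply: relcomp_le => y'; apply: vmor_trans. Qed.

(* f_* : lower star *)
Definition lstar X Y (f : vfun X Y) : distributor X Y :=
  Distributor (lstar_dom f) (lstar_cod f).

Fact ustar_dom X Y (f : vfun X Y) y x :
  ((fun y x => vmor y (f x)) ∙ @vmor d V Y) y x <= vmor y (f x).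
Proof. by apply: relcomp_le => y'; apply: vmor_trans. Qed.

Fact ustar_cod X Y (f : vfun X Y) y x :
  (@vmor d V X ∙ (fun y x => vmor y (f x))) y x <= vmor y (f x).
Proof.
apply: relcomp_le => x'; apply: le_trans (vmor_trans y (f x') (f x)).
by apply: tens_le => //; apply: vfunP.
Qed.

(* f^* : upper star *)
Definition ustar X Y (f : vfun X Y) : distributor Y X :=
  Distributor (ustar_dom f) (ustar_cod f).

(* x^*, for x seen as a V-functor from the one-point V-category *)
Definition ptstar X (x : X) : distributor X (vE V) := ustar (vpoint x).

End Distributors.

Notation "psi ⊙ phi" := (dcomp psi phi) : vcat_scope.

(* The hom-categories of V-Cat being preorders, 2-functoriality amounts to mmap_mono *)
Record monad2 {d : Order.disp_t} (V : quantaleType d) := Monad2 {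
  mobj :> vcat V -> vcat V;
  mmap : forall X Y : vcat V, vfun X Y -> vfun (mobj X) (mobj Y);
  munit : forall X : vcat V, vfun X (mobj X);
  mmult : forall X : vcat V, vfun (mobj (mobj X)) (mobj X);
  mmap_id : forall X, mmap (vid X) = vid (mobj X);
  mmap_comp : forall X Y Z (g : vfun Y Z) (f : vfun X Y),
    mmap (g \vo f) = mmap g \vo mmap f;
  mmap_mono : forall X Y (f g : vfun X Y),
    vfun_le f g -> vfun_le (mmap f) (mmap g);
  munit_nat : forall X Y (f : vfun X Y), mmap f \vo munit X = munit Y \vo f;
  mmult_nat : forall X Y (f : vfun X Y),
    mmap f \vo mmult X = mmult Y \vo mmap (mmap f);
  mmult_unitl : forall X, mmult X \vo munit (mobj X) = vid (mobj X);
  mmult_unitr : forall X, mmult X \vo mmap (munit X) = vid (mobj X);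
  mmult_assoc : forall X,
    mmult X \vo mmult (mobj X) = mmult X \vo mmap (mmult X)
}.

Arguments mmap {d V} m {X Y} f.
Arguments munit {d V} m X.
Arguments mmult {d V} m X.

Record monad_morphism {d : Order.disp_t} {V : quantaleType d}
    (S T : monad2 V) := MonadMorphism {
  mm_fun :> forall X : vcat V, vfun (S X) (T X);
  mm_nat : forall X Y (f : vfun X Y),
    mmap T f \vo mm_fun X = mm_fun Y \vo mmap S f;
  mm_unit : forall X, mm_fun X \vo munit S X = munit T X;
  mm_mult : forall X,
    mmult T X \vo mmap T (mm_fun X) \vo mm_fun (S X) = mm_fun X \vo mmult S X
}.

Definition monad_isomorphic {d : Order.disp_t} {V : quantaleType d}
    (S T : monad2 V) : Prop :=
  exists (s : monad_morphism S T) (t : monad_morphism T S),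
    (forall X, t X \vo s X = vid (S X)) /\
    (forall X, s X \vo t X = vid (T X)).

Section PresheafMonad.
Context {d : Order.disp_t} {V : quantaleType d}.
Implicit Types X Y Z : vcat V.

Definition psh_mor X (phi psi : distributor X (vE V)) : V :=
  vinf [set vhom (phi x tt) (psi x tt) | x in [set: X]].

Lemma le_psh_morP X (phi psi : distributor X (vE V)) v :
  v <= psh_mor phi psi <-> forall x, phi x tt ⊗ v <= psi x tt.
Proof.
split=> [H x|H]; last first.
  by apply: le_vinf => _ [x _ <-]; rewrite -tens_vhom.
by rewrite tens_vhom; apply: le_trans H _; apply: vinf_le; exists x.
Qed.

Lemma psh_mor_ev X (phi psi : distributor X (vE V)) x :
  phi x tt ⊗ psh_mor phi psi <= psi x tt.
Proof. by move: x; apply/le_psh_morP. Qed.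

Fact psh_refl X (phi : distributor X (vE V)) : vone <= psh_mor phi phi.
Proof. by apply/le_psh_morP => x; rewrite tensv1. Qed.

Fact psh_trans X (phi psi chi : distributor X (vE V)) :
  psh_mor phi psi ⊗ psh_mor psi chi <= psh_mor phi chi.
Proof.
apply/le_psh_morP => x; rewrite tensA; apply: le_trans (psh_mor_ev psi chi x).
by apply: tens_le => //; apply: psh_mor_ev.
Qed.

Definition psh X : vcat V := VCat (@psh_refl X) (@psh_trans X).

Lemma pshP X (phi psi : psh X) :
  (forall x, drel phi x tt = drel psi x tt) -> phi = psi.
Proof. by move=> H; apply: distributor_eq => x []. Qed.

Fact psh_map_subproof X Y (f : vfun X Y) (phi psi : psh X) :
  vmor phi psi <= psh_mor (phi ⊙ ustar f) (psi ⊙ ustar f).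
Proof.
apply/le_psh_morP => y; rewrite tensC tens_sup.
apply: vsup_le => _ [_ [x _ <-] <-]; rewrite tensC -tensA.
apply: le_trans (le_relcomp _ _ _ x _); apply: tens_le => //.
exact: psh_mor_ev.
Qed.

Definition psh_map X Y (f : vfun X Y) : vfun (psh X) (psh Y) :=
  @VFun d V (psh X) (psh Y) (fun phi => phi ⊙ ustar f) (psh_map_subproof f).

Fact yoneda_subproof X (x x' : X) : vmor x x' <= psh_mor (ptstar x) (ptstar x').
Proof. by apply/le_psh_morP => z; apply: vmor_trans. Qed.

Definition yoneda X : vfun X (psh X) :=
  @VFun d V X (psh X) (@ptstar d V X) (@yoneda_subproof X).

Lemma yonedaE X (x : X) (phi : psh X) :
  vmor (yoneda X x) phi = drel phi x tt.
Proof.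
apply/le_anti/andP; split; last first.
  by apply/le_psh_morP => z; apply: dist_doml.
apply: le_trans (psh_mor_ev (ptstar x) phi x).
by rewrite -[leLHS]tens1v; apply: tens_le => //; apply: vmor_refl.
Qed.

Fact psh_mult_subproof X (G H : psh (psh X)) :
  vmor G H <= psh_mor (G ⊙ lstar (yoneda X)) (H ⊙ lstar (yoneda X)).
Proof.
apply/le_psh_morP => x; rewrite tensC tens_sup.
apply: vsup_le => _ [_ [phi _ <-] <-]; rewrite tensC -tensA.
apply: le_trans (le_relcomp _ _ _ phi _); apply: tens_le => //.
exact: psh_mor_ev.
Qed.

Definition psh_mult X : vfun (psh (psh X)) (psh X) :=
  @VFun d V (psh (psh X)) (psh X) (fun G => G ⊙ lstar (yoneda X))
    (@psh_mult_subproof X).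

Lemma psh_multE X (G : psh (psh X)) x :
  drel (psh_mult X G) x tt
  = vsup [set drel phi x tt ⊗ drel G phi tt | phi in [set: psh X]].
Proof.
by apply: (congr1 vsup); apply: eq_imagel => phi _; rewrite -(yonedaE x phi).
Qed.

Fact psh_map_id X : psh_map (vid X) = vid (psh X).
Proof.
apply: vfun_eq => phi; apply: pshP => x; apply/le_anti/andP; split.
  by apply: relcomp_le => y; apply: dist_doml.
apply: le_trans (le_relcomp _ _ _ x _).
by rewrite -[leLHS]tens1v; apply: tens_le => //; apply: vmor_refl.
Qed.

Lemma ustar_comp X Y Z (g : vfun Y Z) (f : vfun X Y) :
  ustar (g \vo f) = ustar f ⊙ ustar g.
Proof.
apply: distributor_eq => z x; apply/le_anti/andP; split.
  apply: le_trans (le_relcomp _ _ _ (f x) _).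
  by rewrite -[leLHS]tensv1; apply: tens_le => //; apply: vmor_refl.
apply: relcomp_le => y; apply: le_trans (vmor_trans z (g y) _).
by apply: tens_le => //; apply: vfunP.
Qed.

Lemma dcompA X Y Z W (t : distributor Z W) (s : distributor Y Z)
  (r : distributor X Y) : t ⊙ (s ⊙ r) = (t ⊙ s) ⊙ r.
Proof. by apply: distributor_eq => x w /=; rewrite relcompA. Qed.

Fact psh_map_comp X Y Z (g : vfun Y Z) (f : vfun X Y) :
  psh_map (g \vo f) = psh_map g \vo psh_map f.
Proof. by apply: vfun_eq => phi /=; rewrite ustar_comp dcompA. Qed.

Fact psh_map_mono X Y (f g : vfun X Y) :
  vfun_le f g -> vfun_le (psh_map f) (psh_map g).
Proof.
move=> fg phi; apply/le_psh_morP => y; rewrite tensv1.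
apply: relcomp_mono => // y' x; apply: le_trans (vmor_trans y' (f x) (g x)).
by rewrite -[leLHS]tensv1; apply: tens_mono; apply: fg.
Qed.

Fact yoneda_nat X Y (f : vfun X Y) : psh_map f \vo yoneda X = yoneda Y \vo f.
Proof.
apply: vfun_eq => x /=; apply: pshP => y.
by rewrite /ptstar -ustar_comp.
Qed.

Lemma lstar_yoneda_nat X Y (f : vfun X Y) :
  ustar (psh_map f) ⊙ lstar (yoneda Y) = lstar (yoneda X) ⊙ ustar f.
Proof.
apply: distributor_eq => y phi; transitivity (drel (psh_map f phi) y tt).
  apply/le_anti/andP; split.
    by apply: relcomp_le => psi; rewrite -[leRHS]yonedaE; apply: vmor_trans.
  apply: le_trans (le_relcomp _ _ _ (psh_map f phi) _).
  rewrite -[leLHS]tensv1 -[X in X ⊗ _]yonedaE.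
  by apply: tens_le => //; apply: vmor_refl.
by apply: (congr1 vsup); apply: eq_imagel => x _; rewrite -yonedaE.
Qed.

Fact psh_mult_nat X Y (f : vfun X Y) :
  psh_map f \vo psh_mult X = psh_mult Y \vo psh_map (psh_map f).
Proof.
by apply: vfun_eq => G /=; rewrite -!dcompA lstar_yoneda_nat.
Qed.

Fact psh_mult_unitl X : psh_mult X \vo yoneda (psh X) = vid (psh X).
Proof.
apply: vfun_eq => phi; apply: pshP => x /=.
apply/le_anti/andP; split.
  by apply: relcomp_le => psi; rewrite -[leRHS]yonedaE;
  exact: (vmor_trans (yoneda X x) psi (phi : psh X)).
apply: le_trans (le_relcomp _ _ _ phi _).
rewrite -[leLHS]tensv1 -[X in X ⊗ _]yonedaE.
by apply: tens_le => //; apply: (vmor_refl (phi : psh X)).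
Qed.

Fact psh_mult_unitr X : psh_mult X \vo psh_map (yoneda X) = vid (psh X).
Proof.
apply: vfun_eq => phi; rewrite -[RHS]/(vid (psh X) phi) -psh_map_id /=.
rewrite -dcompA; congr (_ ⊙ _); apply: distributor_eq => x z.
apply/le_anti/andP; split; last first.
  apply: le_trans (le_relcomp _ _ _ (yoneda X z) _).
  rewrite -[leLHS]tensv1 [drel (lstar _) _ _]yonedaE.
  by apply: tens_le => //; apply: (vmor_refl (yoneda X z)).
apply: relcomp_le => psi.
by apply: le_trans (vmor_trans (yoneda X x) psi (yoneda X z)) _; rewrite yonedaE.
Qed.

Fact psh_mult_assoc X :
  psh_mult X \vo psh_mult (psh X) = psh_mult X \vo psh_map (psh_mult X).
Proof.
apply: vfun_eq => G /=; rewrite -!dcompA; congr (_ ⊙ _).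
apply: distributor_eq => x L; transitivity (drel (psh_mult X L) x tt).
  by apply: (congr1 vsup); apply: eq_imagel => phi _; rewrite -(yonedaE phi L).
apply/le_anti/andP; split; last first.
  apply: relcomp_le => psi; rewrite -[leRHS]yonedaE.
  exact: (vmor_trans (yoneda X x) psi (psh_mult X L)).
apply: le_trans (le_relcomp _ _ _ (psh_mult X L) _).
rewrite -[leLHS]tensv1 -[X in X ⊗ _]yonedaE.
by apply: tens_le => //; apply: (vmor_refl (psh_mult X L)).
Qed.

Definition presheaf_monad : monad2 V :=
  Monad2 psh_map_id psh_map_comp psh_map_mono yoneda_nat psh_mult_nat
    psh_mult_unitl psh_mult_unitr psh_mult_assoc.

End PresheafMonad.

Arguments presheaf_monad {d} V.

Definition is_presheaf_submonad {d : Order.disp_t} {V : quantaleType d}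
    (T : monad2 V) : Prop :=
  exists sigma : monad_morphism T (presheaf_monad V),
    forall X, vembedding (sigma X).

Definition dclass {d : Order.disp_t} (V : quantaleType d) :=
  forall X Y : vcat V, distributor X Y -> Prop.

Section Admissible.
Context {d : Order.disp_t} {V : quantaleType d}.
Implicit Types (X Y Z : vcat V).

Definition phi_psh (Phi : dclass V) X : vcat V :=
  @VCat d V {phi : psh X | Phi X (vE V) phi}
    (fun phi psi => vmor (sval phi) (sval psi))
    (fun phi => vmor_refl (sval phi))
    (fun phi psi chi => vmor_trans (sval phi) (sval psi) (sval chi)).

Definition phi_incl (Phi : dclass V) X : vfun (phi_psh Phi X) (psh X) :=
  @VFun d V (phi_psh Phi X) (psh X) (fun phi => sval phi)
    (fun phi psi => lexx (vmor (sval phi) (sval psi))).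

Fact drestrict_dom (Phi : dclass V) X (gamma : distributor (psh X) (vE V)) p e :
  ((fun p e => gamma (sval p) e) ∙ @vmor d V (phi_psh Phi X)) p e
    <= gamma (sval p) e.
Proof. by apply: relcomp_le => q; apply: (dist_doml gamma (sval p) (sval q)). Qed.

Fact drestrict_cod (Phi : dclass V) X (gamma : distributor (psh X) (vE V))
    (p : phi_psh Phi X) e :
  (@vmor d V (vE V) ∙ (fun (p : phi_psh Phi X) e => gamma (sval p) e)) p e
    <= gamma (sval p) e.
Proof. by apply: relcomp_le => q; apply: dist_codr. Qed.

(* gamma restricted, as a map, to the full sub-V-category phi_psh Phi X of psh X *)
Definition drestrict (Phi : dclass V) X (gamma : distributor (psh X) (vE V)) :
  distributor (phi_psh Phi X) (vE V) :=
  Distributor (@drestrict_dom Phi X gamma) (@drestrict_cod Phi X gamma).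

Record admissible (Phi : dclass V) : Prop := Admissible {
  adm_ustar : forall X Y (f : vfun X Y), Phi Y X (ustar f);
  adm_compr : forall X Y Z (f : vfun X Y) (psi : distributor X Z),
    Phi X Z psi -> Phi Y Z (psi ⊙ ustar f);
  adm_compl : forall X Y Z (f : vfun X Y) (phi : distributor Z Y),
    Phi Z Y phi -> Phi Z X (ustar f ⊙ phi);
  adm_pointwise : forall Y Z (phi : distributor Z Y),
    Phi Z Y phi <-> forall y : Y, Phi Z (vE V) (ptstar y ⊙ phi);
  adm_mult : forall X (gamma : distributor (psh X) (vE V)),
    Phi (phi_psh Phi X) (vE V) (drestrict Phi gamma) ->
    Phi X (vE V) (gamma ⊙ lstar (yoneda X))
}.

End Admissible.

Section InducedMonad.
Context {d : Order.disp_t} {V : quantaleType d}.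
Context {Phi : dclass V} (adm : admissible Phi).
Implicit Types (X Y Z : vcat V).

Lemma phi_pshP X (phi psi : phi_psh Phi X) : sval phi = sval psi -> phi = psi.
Proof.
by case: phi psi => [p pP] [q qP] /= pq; case: _ / pq qP => qP; congr exist.
Qed.

Definition phi_map X Y (f : vfun X Y) : vfun (phi_psh Phi X) (phi_psh Phi Y) :=
  @VFun d V (phi_psh Phi X) (phi_psh Phi Y)
    (fun phi => exist _ (psh_map f (sval phi))
                  (adm_compr adm f (proj2_sig phi)))
    (fun phi psi => vfunP (psh_map f) (sval phi) (sval psi)).

Definition phi_unit X : vfun X (phi_psh Phi X) :=
  @VFun d V X (phi_psh Phi X)
    (fun x => exist _ (yoneda X x) (adm_ustar adm (vpoint x)))
    (fun x x' => vfunP (yoneda X) x x').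

Lemma phi_multE X (gamma : distributor (phi_psh Phi X) (vE V)) :
  gamma ⊙ lstar (phi_unit X)
  = psh_mult X (psh_map (phi_incl Phi X) gamma).
Proof.
rewrite /= -dcompA; congr (_ ⊙ _); apply: distributor_eq => x phi.
apply/le_anti/andP; split; last first.
  apply: relcomp_le => psi.
  exact: (vmor_trans (yoneda X x) psi (sval phi)).
apply: le_trans (le_relcomp _ _ _ (sval phi) _).
rewrite -[leLHS]tensv1; apply: tens_le => //.
exact: (vmor_refl (sval phi)).
Qed.

Lemma drestrict_incl X (gamma : distributor (phi_psh Phi X) (vE V)) :
  drestrict Phi (psh_map (phi_incl Phi X) gamma) = gamma.
Proof.
apply: distributor_eq => phi [] /=; apply/le_anti/andP; split.
  by apply: relcomp_le => psi; apply: (dist_doml gamma).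
apply: le_trans (le_relcomp _ _ _ phi _).
rewrite -[leLHS]tens1v; apply: tens_le => //.
exact: (vmor_refl (sval phi)).
Qed.

Fact phi_mult_subproof1 X (gamma : phi_psh Phi (phi_psh Phi X)) :
  Phi (sval gamma ⊙ lstar (phi_unit X)).
Proof.
rewrite phi_multE; apply: (adm_mult adm); rewrite drestrict_incl.
exact: (proj2_sig gamma).
Qed.

Fact phi_mult_subproof2 X (gamma delta : phi_psh Phi (phi_psh Phi X)) :
  vmor gamma delta
  <= psh_mor (sval gamma ⊙ lstar (phi_unit X)) (sval delta ⊙ lstar (phi_unit X)).
Proof.
rewrite !phi_multE.
exact: (vfunP (psh_mult X \vo psh_map (phi_incl Phi X)) (sval gamma)).
Qed.

Definition phi_mult X :
    vfun (phi_psh Phi (phi_psh Phi X)) (phi_psh Phi X) :=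
  @VFun d V (phi_psh Phi (phi_psh Phi X)) (phi_psh Phi X)
    (fun gamma => exist _ (sval gamma ⊙ lstar (phi_unit X))
                    (phi_mult_subproof1 gamma))
    (@phi_mult_subproof2 X).

Lemma phi_incl_inj X Y (f g : vfun Y (phi_psh Phi X)) :
  phi_incl Phi X \vo f = phi_incl Phi X \vo g -> f = g.
Proof.
move=> fg; apply: vfun_eq => y; apply: phi_pshP.
by have := congr1 (fun h : vfun _ _ => h y) fg.
Qed.

Lemma vcompA (X Y Z W : vcat V) (h : vfun Z W) (g : vfun Y Z) (f : vfun X Y) :
  h \vo (g \vo f) = h \vo g \vo f.
Proof. exact: vfun_eq. Qed.

Lemma vcomp1 X Y (f : vfun X Y) : f \vo vid X = f.
Proof. exact: vfun_eq. Qed.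

Lemma vcomp1l X Y (f : vfun X Y) : vid Y \vo f = f.
Proof. exact: vfun_eq. Qed.

Lemma phi_incl_map X Y (f : vfun X Y) :
  phi_incl Phi Y \vo phi_map f = psh_map f \vo phi_incl Phi X.
Proof. exact: vfun_eq. Qed.

Lemma phi_incl_unit X : phi_incl Phi X \vo phi_unit X = yoneda X.
Proof. exact: vfun_eq. Qed.

Lemma phi_incl_mult X :
  phi_incl Phi X \vo phi_mult X
  = psh_mult X \vo psh_map (phi_incl Phi X) \vo phi_incl Phi (phi_psh Phi X).
Proof. by apply: vfun_eq => gamma; apply: phi_multE. Qed.

Fact phi_map_id X : phi_map (vid X) = vid (phi_psh Phi X).
Proof. by apply: phi_incl_inj; rewrite phi_incl_map psh_map_id vcomp1 vcomp1l. Qed.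

Fact phi_map_comp X Y Z (g : vfun Y Z) (f : vfun X Y) :
  phi_map (g \vo f) = phi_map g \vo phi_map f.
Proof.
apply: phi_incl_inj.
by rewrite phi_incl_map psh_map_comp vcompA phi_incl_map -!vcompA phi_incl_map.
Qed.

Fact phi_map_mono X Y (f g : vfun X Y) :
  vfun_le f g -> vfun_le (phi_map f) (phi_map g).
Proof. by move=> /psh_map_mono fg phi; apply: fg. Qed.

Fact phi_unit_nat X Y (f : vfun X Y) :
  phi_map f \vo phi_unit X = phi_unit Y \vo f.
Proof.
apply: phi_incl_inj.
by rewrite !vcompA phi_incl_map -vcompA !phi_incl_unit yoneda_nat.
Qed.

Fact phi_mult_nat X Y (f : vfun X Y) :
  phi_map f \vo phi_mult X = phi_mult Y \vo phi_map (phi_map f).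
Proof.
apply: phi_incl_inj.
rewrite !vcompA phi_incl_map phi_incl_mult -!vcompA phi_incl_map phi_incl_mult.
rewrite !vcompA psh_mult_nat -![psh_mult Y \vo _ \vo psh_map _]vcompA.
by rewrite -!psh_map_comp phi_incl_map.
Qed.

Fact phi_mult_unitl X :
  phi_mult X \vo phi_unit (phi_psh Phi X) = vid (phi_psh Phi X).
Proof.
apply: phi_incl_inj.
rewrite vcompA phi_incl_mult -!vcompA phi_incl_unit yoneda_nat.
by rewrite !vcompA psh_mult_unitl vcomp1l vcomp1.
Qed.

Fact phi_mult_unitr X :
  phi_mult X \vo phi_map (phi_unit X) = vid (phi_psh Phi X).
Proof.
apply: phi_incl_inj.
rewrite vcompA phi_incl_mult -!vcompA phi_incl_map.
rewrite (vcompA (psh_map (phi_incl Phi X))) -psh_map_comp phi_incl_unit.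
by rewrite vcompA psh_mult_unitr vcomp1l vcomp1.
Qed.

Fact phi_mult_assoc X :
  phi_mult X \vo phi_mult (phi_psh Phi X) = phi_mult X \vo phi_map (phi_mult X).
Proof.
apply: phi_incl_inj.
rewrite !vcompA phi_incl_mult -!vcompA phi_incl_map phi_incl_mult.
rewrite (vcompA (psh_map (phi_incl Phi X)) (psh_map (phi_mult X))).
rewrite -psh_map_comp phi_incl_mult !psh_map_comp !vcompA -psh_mult_assoc.
by rewrite -2!(vcompA (psh_mult X)) psh_mult_nat !vcompA.
Qed.

Definition induced_monad : monad2 V :=
  Monad2 phi_map_id phi_map_comp phi_map_mono phi_unit_nat phi_mult_nat
    phi_mult_unitl phi_mult_unitr phi_mult_assoc.

End InducedMonad.

(* Main.v *)
Require Import Defs.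
From HB Require Import structures.
From mathcomp Require Import all_boot all_order.
From mathcomp Require Import boolp classical_sets.

(** Given an embedding sigma of T into the presheaf monad, let Phi consist of
    the distributors phi from Z to Y such that every y^* . phi lies in the image
    of sigma_Z, so that sigma corestricts to a bijection from TX to Phi X.  The
    only substantial axiom of admissibility is the last one: a distributor gamma
    on PX satisfies (gamma . y_* )(x) = gamma(x^* ), and x^* lies in Phi X, so
    gamma . y_* depends only on the restriction of gamma to Phi X; transporting
    that restriction along TX = Phi X yields an element of TTX, whose
    multiplication in T is mapped by sigma to gamma . y_*. *)

Set Implicit Arguments.
Unset Strict Implicit.
Unset Printing Implicit Defensive.

Import Order.TTheory.

Local Open Scope classical_set_scope.
Local Open Scope order_scope.
Local Open Scope vcat_scope.

(** * Embeddings of V-categories *)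

Section VFunctors.
Context {d : Order.disp_t} {V : quantaleType d}.
Implicit Types X Y Z : vcat V.

Lemma vfun_eqE X Y (f g : vfun X Y) : f = g -> f =1 g.
Proof. by move=> ->. Qed.

Lemma vfun_retract_fully_faithful X Y (f : vfun X Y) (g : vfun Y X) :
  g \vo f = vid X -> fully_faithful f.
Proof.
move=> /vfun_eqE gf x x'; apply/le_anti/andP; split; first exact: vfunP.
by have := vfunP g (f x) (f x'); rewrite [g (f x)]gf [g (f x')]gf.
Qed.

Lemma vembedding_comp X Y Z (g : vfun Y Z) (f : vfun X Y) :
  vembedding g -> vembedding f -> vembedding (g \vo f).
Proof.
move=> [gff ginj] [fff finj]; split; last exact: inj_comp.
by move=> x x'; rewrite fff gff.
Qed.

End VFunctors.

(** * Composition and inversion of monad morphisms *)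

Section MonadMorphisms.
Context {d : Order.disp_t} {V : quantaleType d}.

Section Comp.
Variables (S T U : monad2 V) (r : monad_morphism T U) (s : monad_morphism S T).

Fact mm_comp_nat X Y (f : vfun X Y) :
  mmap U f \vo (r X \vo s X) = (r Y \vo s Y) \vo mmap S f.
Proof. by rewrite vcompA mm_nat -!vcompA mm_nat. Qed.

Fact mm_comp_unit X : (r X \vo s X) \vo munit S X = munit U X.
Proof. by rewrite -vcompA !mm_unit. Qed.

Fact mm_comp_mult X :
  mmult U X \vo mmap U (r X \vo s X) \vo (r (S X) \vo s (S X))
  = (r X \vo s X) \vo mmult S X.
Proof.
rewrite -[RHS]vcompA -mm_mult !vcompA -mm_mult mmap_comp !vcompA.
(* Naturality of [r] at [s X] moves [mmap U (s X)] past [r (S X)]. *)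
by rewrite -(vcompA _ (mmap U (s X)) (r (S X))) mm_nat !vcompA.
Qed.

Definition mm_comp : monad_morphism S U :=
  MonadMorphism mm_comp_nat mm_comp_unit mm_comp_mult.

End Comp.

Section Inverse.
Variables (S T : monad2 V) (s : monad_morphism S T).
Variable t : forall X, vfun (T X) (S X).
Hypothesis ts : forall X, t X \vo s X = vid (S X).
Hypothesis st : forall X, s X \vo t X = vid (T X).

Fact mm_inv_nat X Y (f : vfun X Y) :
  mmap S f \vo t X = t Y \vo mmap T f.
Proof.
rewrite -[RHS]vcomp1 -(st X) vcompA -(vcompA (t Y)) mm_nat.
by rewrite (vcompA (t Y)) ts vcomp1l.
Qed.

Fact mm_inv_unit X : t X \vo munit T X = munit S X.
Proof. by rewrite -(mm_unit s) vcompA ts vcomp1l. Qed.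

Fact mm_inv_mult X :
  mmult S X \vo mmap S (t X) \vo t (T X) = t X \vo mmult T X.
Proof.
rewrite -vcompA mm_inv_nat -[RHS]vcomp1 -(mmap_id T) -(st X) mmap_comp.
rewrite -[mmap T (s X) \vo _]vcomp1 -[mmult S X]vcomp1l -(ts X).
(* Having surrounded [mmult S X] by [s] and [t], one applies the multiplication law of [s]; the two
   sides then differ by an inserted identity [s (S X) \vo t (S X)]. *)
rewrite -(vcompA (t X)) -mm_mult.
have -> : mmap T (s X) \vo mmap T (t X) \vo vid (T (T X))
        = mmap T (s X) \vo (s (S X) \vo t (S X)) \vo mmap T (t X).
  by rewrite st !vcomp1.
by rewrite !vcompA.
Qed.

Definition mm_inv : monad_morphism T S :=
  MonadMorphism mm_inv_nat mm_inv_unit mm_inv_mult.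

End Inverse.

Section Inclusion.
Context {Phi : dclass V} (adm : admissible Phi).

Definition phi_incl_mm : monad_morphism (induced_monad adm) (presheaf_monad V) :=
  @MonadMorphism d V (induced_monad adm) (presheaf_monad V) (phi_incl Phi)
    (fun X Y f => esym (phi_incl_map adm f)) (phi_incl_unit adm)
    (fun X => esym (phi_incl_mult adm X)).

Lemma phi_incl_vembedding X : vembedding (phi_incl Phi X).
Proof. by split=> // p q; apply: phi_pshP. Qed.

End Inclusion.

End MonadMorphisms.

(** * Evaluation of distributors at points *)

Section DistributorPoints.
Context {d : Order.disp_t} {V : quantaleType d}.
Implicit Types X Y Z : vcat V.

Lemma ptstar_dcompE Y Z (phi : distributor Z Y) (y : Y) z :
  drel (ptstar y ⊙ phi) z tt = phi z y.
Proof.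
apply/le_anti/andP; split; first by apply: relcomp_le => y'; apply: dist_codr.
apply: le_trans (le_relcomp _ _ _ y _).
by rewrite -[leLHS]tensv1; apply: tens_le => //; apply: vmor_refl.
Qed.

Lemma ptstar_vE X (e : vE V) (phi : psh X) : ptstar e ⊙ phi = phi.
Proof. by apply: pshP => x; rewrite ptstar_dcompE; case: e. Qed.

Lemma ptstar_ustar X Y (f : vfun X Y) (x : X) :
  ptstar x ⊙ ustar f = ptstar (f x).
Proof. by rewrite /ptstar -ustar_comp; congr ustar; apply: vfun_eq. Qed.

(** The join over all presheaves is attained at $x^*$, because [G] is contravariant along
    $PX(x^*,\varphi)$. *)
Lemma psh_mult_yoneda X (G : psh (psh X)) x :
  drel (psh_mult X G) x tt = drel G (yoneda X x) tt.
Proof.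
apply/le_anti/andP; split; first by apply: relcomp_le => phi; apply: dist_doml.
apply: le_trans (le_relcomp _ _ _ (yoneda X x) _).
by rewrite -[leLHS]tens1v; apply: tens_le => //; apply: vmor_refl.
Qed.

End DistributorPoints.

(** * The admissible class of a submonad *)

Section SubmonadClass.
Context {d : Order.disp_t} {V : quantaleType d}.
Implicit Types X Y Z : vcat V.
Variables (T : monad2 V) (sigma : monad_morphism T (presheaf_monad V)).
Hypothesis sigma_emb : forall X, vembedding (sigma X).

(** Quantifying over the points of the codomain extends a class of presheaves to all distributors
    and builds in the pointwise axiom. *)
Definition submonad_class : dclass V := fun Z Y phi =>
  forall y : Y, exists t : T Z, sigma Z t = ptstar y ⊙ phi.

Lemma submonad_class_psh X (phi : psh X) :
  submonad_class phi <-> exists t : T X, sigma X t = phi.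
Proof.
split=> [/(_ tt)|[t <-] y]; first by rewrite ptstar_vE.
by exists t; rewrite ptstar_vE.
Qed.

Definition submonad_corestr X : vfun (T X) (phi_psh submonad_class X) :=
  @VFun d V (T X) (phi_psh submonad_class X)
    (fun t => exist _ (sigma X t)
      ((submonad_class_psh (sigma X t)).2 (ex_intro _ t erefl)))
    (fun t t' => vfunP (sigma X) t t').

Lemma phi_incl_corestr X :
  phi_incl submonad_class X \vo submonad_corestr X = sigma X.
Proof. exact: vfun_eq. Qed.

(** The preimage is chosen classically; injectivity of [sigma X] makes it unique. *)
Definition submonad_lift X (p : phi_psh submonad_class X) : T X :=
  sval (cid ((submonad_class_psh (sval p)).1 (proj2_sig p))).

Lemma submonad_liftK X (p : phi_psh submonad_class X) :
  sigma X (submonad_lift p) = sval p.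
Proof. by rewrite /submonad_lift; case: cid. Qed.

Fact submonad_lift_subproof X (p q : phi_psh submonad_class X) :
  vmor p q <= vmor (submonad_lift p) (submonad_lift q).
Proof. by rewrite (sigma_emb X).1 !submonad_liftK. Qed.

Definition submonad_corestr_inv X : vfun (phi_psh submonad_class X) (T X) :=
  VFun (@submonad_lift_subproof X).

Lemma submonad_corestrK X :
  submonad_corestr_inv X \vo submonad_corestr X = vid (T X).
Proof.
by apply: vfun_eq => t; apply: (sigma_emb X).2; rewrite /= submonad_liftK.
Qed.

Lemma submonad_corestr_invK X :
  submonad_corestr X \vo submonad_corestr_inv X = vid (phi_psh submonad_class X).
Proof. by apply: vfun_eq => p; apply: phi_pshP; rewrite /= submonad_liftK. Qed.

Lemma submonad_class_yoneda X (x : X) : submonad_class (yoneda X x).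
Proof.
apply/submonad_class_psh; exists (munit T X x).
exact: vfun_eqE (mm_unit sigma X) x.
Qed.

(** Restricting and then extending along the inclusion preserves the values at representables, which
    lie in the class, and [psh_mult] reads only those values. *)
Lemma psh_mult_drestrict X (gamma : psh (psh X)) :
  psh_mult X (psh_map (phi_incl submonad_class X)
                (drestrict submonad_class gamma))
  = psh_mult X gamma.
Proof.
apply: pshP => x; rewrite !psh_mult_yoneda; apply/le_anti/andP; split.
  by apply: relcomp_le => p; apply: dist_doml.
pose p : phi_psh submonad_class X := exist _ _ (submonad_class_yoneda x).
apply: le_trans (le_relcomp _ _ _ p _).
by rewrite -[leLHS]tens1v; apply: tens_le => //; apply: (vmor_refl (yoneda X x)).
Qed.

Lemma submonad_class_admissible : admissible submonad_class.
Proof.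
split.
- move=> X Y f x; rewrite ptstar_ustar.
  by have /submonad_class_psh := submonad_class_yoneda (f x).
- move=> X Y Z f psi Hpsi z; have [t Ht] := Hpsi z.
  (* Naturality of [sigma] sends this witness to $Pf$ of the presheaf given by [t]. *)
  exists (mmap T f t); rewrite dcompA -Ht.
  by rewrite [LHS](esym (vfun_eqE (mm_nat sigma f) t)).
- move=> X Y Z f phi Hphi x; rewrite dcompA ptstar_ustar; exact: Hphi.
- move=> Y Z phi; split=> H y; last by have /submonad_class_psh := H y.
  by apply/submonad_class_psh; apply: H.
- move=> X gamma /submonad_class_psh[t Ht]; apply/submonad_class_psh.
  exists (mmult T X (mmap T (submonad_corestr_inv X) t)).
  rewrite [LHS](esym (vfun_eqE (mm_mult sigma X) _)) /=.
  rewrite [sigma (T X) _](esym (vfun_eqE (mm_nat sigma (submonad_corestr_inv X)) t)).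
  rewrite /= [sigma _ t]Ht; rewrite -[RHS]psh_mult_drestrict /=.
  (* The two successive pushforwards merge into one along [sigma X \vo submonad_corestr_inv X],
     which is the inclusion. *)
  rewrite -(dcompA (drestrict _ _)) -ustar_comp.
  congr (_ ⊙ ustar _ ⊙ _).
  by rewrite -phi_incl_corestr -vcompA submonad_corestr_invK vcomp1.
Qed.

Let adm := submonad_class_admissible.

(** Inclusions into [psh] are monic, so this law and the next two reduce to those of [sigma]. *)
Fact submonad_corestr_nat X Y (f : vfun X Y) :
  mmap (induced_monad adm) f \vo submonad_corestr X
  = submonad_corestr Y \vo mmap T f.
Proof.
apply: phi_incl_inj; rewrite !vcompA phi_incl_map -(vcompA (psh_map f)) !phi_incl_corestr.
exact: (mm_nat sigma).
Qed.

Fact submonad_corestr_unit X :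
  submonad_corestr X \vo munit T X = munit (induced_monad adm) X.
Proof.
apply: phi_incl_inj; rewrite vcompA phi_incl_corestr phi_incl_unit.
exact: (mm_unit sigma).
Qed.

Fact submonad_corestr_mult X :
  mmult (induced_monad adm) X \vo mmap (induced_monad adm) (submonad_corestr X)
    \vo submonad_corestr (T X)
  = submonad_corestr X \vo mmult T X.
Proof.
apply: phi_incl_inj; rewrite !vcompA phi_incl_mult phi_incl_corestr.
rewrite -(vcompA _ (phi_incl _ _)) phi_incl_map.
rewrite -!vcompA phi_incl_corestr (vcompA (psh_map (phi_incl _ _))).
rewrite -psh_map_comp phi_incl_corestr vcompA.
exact: (mm_mult sigma).
Qed.

Definition submonad_corestr_mm : monad_morphism T (induced_monad adm) :=
  MonadMorphism submonad_corestr_nat submonad_corestr_unit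
    submonad_corestr_mult.

Lemma submonad_isomorphic_induced : monad_isomorphic T (induced_monad adm).
Proof.
exists submonad_corestr_mm.
by exists (@mm_inv _ _ _ _ submonad_corestr_mm submonad_corestr_inv
             submonad_corestrK submonad_corestr_invK); split;
  [exact: submonad_corestrK | exact: submonad_corestr_invK].
Qed.

End SubmonadClass.

Theorem theorem2p3 (d : Order.disp_t) (V : quantaleType d) (T : monad2 V) :
  (exists (Phi : dclass V) (adm : admissible Phi),
     monad_isomorphic T (induced_monad adm)) <->
  is_presheaf_submonad T.
Proof.
split=> [[Phi [adm [s [t [ts _]]]]]|[sigma sigma_emb]].
  (* The isomorphism followed by the inclusion; [s X] is an embedding since [t X] is a left
     inverse. *)
  exists (mm_comp (phi_incl_mm adm) s) => X.
  apply: vembedding_comp; first exact: phi_incl_vembedding.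
  split; first exact: vfun_retract_fully_faithful (ts X).
  by apply: (@can_inj _ _ _ (t X)); apply: vfun_eqE (ts X).
exists (submonad_class sigma), (submonad_class_admissible sigma_emb).
exact: submonad_isomorphic_induced.
Qed.
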